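(* Let $\mathcal A$ be an implicative algebra with separator $\mathscr S$ and let $M\subseteq\mathscr S$ be a (nonempty) algebraic subset. The following are equivalent: (i) $M$ is dense in $\mathscr S$; (ii) for every set $X$ and every family $u=(u_x)_{x\in X}$ of elements of $\mathscr S$ there is a valuation $\nu:X\to\mathfrak P_\bullet(M)$ such that $u\cong_X \mathrm{ex}\,\nu$; (iii) the canonical functor $\mathcal U:(\mathbf{Asm}_M)_{\mathrm{reg/lex}}\to\mathbf{Asm}_{\mathcal A}$ is essentially surjective.
   Context: An implicative structure is a complete lattice $(\mathcal A,\preccurlyeq)$ with a binary operation $\to$, antitone in the first and monotone in the second argument, such that $a\to\bigwedge B=\bigwedge_{b\in B}(a\to b)$ for all $a\in\mathcal A$, $B\subseteq\mathcal A$. An implicative algebra is an implicative structure with a separator $\mathscr S\subseteq\mathcal A$: an upward closed subset containing $\bigwedge_{a,b}(a\to(b\to a))$ and $\bigwedge_{a,b,c}((a\to(b\to c))\to((a\to b)\to(a\to c)))$ and closed under modus ponens ($a\in\mathscr S$ and $(a\to b)\in\mathscr S$ imply $b\in\mathscr S$). Put $a\sqcap b:=\bigwedge_{c\in\mathcal A}((a\to(b\to c))\to c)$ and, for $U\subseteq\mathcal A$, $\mathrm{ex}(U):=\bigwedge_{c\in\mathcal A}\big((\bigwedge_{u\in U}(u\to c))\to c\big)$. For families $u,v:X\to\mathcal A$ write $u\sqsubseteq_X v$ if $\bigwedge_{x\in X}(u_x\to v_x)\in\mathscr S$, and $u\cong_X v$ if $u\sqsubseteq_X v$ and $v\sqsubseteq_X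 u$. An assembly is a set $X$ with a map $\mathsf E_X:X\to\mathscr S$; a morphism of assemblies $X\to Y$ is a map $f$ which is tracked, i.e. $\bigwedge_{x\in X}(\mathsf E_X(x)\to\mathsf E_Y(f(x)))\in\mathscr S$. These form the category $\mathbf{Asm}_{\mathcal A}$ (a quasitopos, hence regular). For $M\subseteq\mathscr S$, $\mathbf{Asm}_M$ is the full subcategory on assemblies with $\mathsf E_X$ valued in $M$. $M$ is algebraic if it is closed under $\sqcap$; then $\mathbf{Asm}_M$ is closed under finite limits in $\mathbf{Asm}_{\mathcal A}$. The image of $f:X\to Y$ in $\mathbf{Asm}_{\mathcal A}$ is the assembly $\mathrm{Im}(f)$ with carrier $\{[x]\mid x\in X\}$, $[x]=f^{-1}(f(x))$, and $\mathsf E_{\mathrm{Im}(f)}([x])=\mathrm{ex}\{\mathsf E_X(x')\mid x'\in[x]\}$; $f=\iota_f\circ\bar f$ with $\bar f(x)=[x]$ regular epi and $\iota_f([x])=f(x)$ mono. The regular completion $\mathbb C_{\mathrm{reg/lex}}$ of a category $\mathbb C$ with finite limits has as objects the morphisms $f:X\to Y$ of $\mathbb C$; a morphism from $(f:X\to Y)$ to $(f':X'\to Y')$ is an equivalence class $[l]$ of morphisms $l:X\to X'$ such that $f'\circ l$ coequalises the kernel pair of $f$, where $[l_1]=[l_2]$ iff $f'\circ l_1=f'\circ l_2$. The functor $\mathcal U:(\mathbf{Asm}_M)_{\mathrm{reg/lex}}\to\mathbf{Asm}_{\mathcal A}$ sends $f$ to $\mathrm{Im}(f)$ and $[l]$ to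 the unique $\tilde l:\mathrm{Im}(f)\to\mathrm{Im}(f')$ with $\tilde l\circ\bar f=\overline{f'}\circ l$. $\mathfrak P_\bullet(M)$ is the set of nonempty subsets of $M$. A valuation is a map $\nu:X\to\mathfrak P_\bullet(M)$; $\mathrm{ex}\,\nu$ denotes the family $(\mathrm{ex}(\nu(x)))_{x\in X}$. A nonempty $M\subseteq\mathscr S$ is dense in $\mathscr S$ if there is a valuation $\nu:\mathscr S\to\mathfrak P_\bullet(M)$ with $\mathrm{id}_{\mathscr S}\cong_{\mathscr S}\mathrm{ex}\,\nu$. *)

(* Defs.v *)
From HB Require Import structures.
From mathcomp Require Import all_boot all_order.
From mathcomp Require Import boolp classical_sets.

Set Implicit Arguments.
Unset Strict Implicit.
Unset Printing Implicit Defensive.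

Local Open Scope classical_set_scope.
Local Open Scope order_scope.

Declare Scope implicative_scope.
Delimit Scope implicative_scope with I.
Local Open Scope implicative_scope.

HB.mixin Record POrder_isCompleteLattice d T of Order.POrder d T := {
  bigmeet : set T -> T;
  bigjoin : set T -> T;
  bigmeetP : forall U : set T, infimums U (bigmeet U);
  bigjoinP : forall U : set T, supremums U (bigjoin U)
}.

#[short(type="completeLatticeType")]
HB.structure Definition CompleteLattice d :=
  {T of POrder_isCompleteLattice d T & Order.POrder d T}.

HB.mixin Record CompleteLattice_isImplicative d T of CompleteLattice d T := {
  imp : T -> T -> T;
  imp_antil : forall a a' b : T, a <= a' -> imp a' b <= imp a b;
  imp_monor : forall a b b' : T, b <= b' -> imp a b <= imp a b';
  imp_bigmeet : forall (a : T) (B : set T),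
    imp a (bigmeet B) = bigmeet [set imp a b | b in B]
}.

#[short(type="implicativeType")]
HB.structure Definition Implicative d :=
  {T of CompleteLattice_isImplicative d T & CompleteLattice d T}.

Notation "a ~> b" := (imp a b)
  (at level 55, right associativity) : implicative_scope.

Definition imeet d (A : completeLatticeType d) (I : Type) (F : I -> A) : A :=
  bigmeet (range F).

Notation "⨅ x .. y , t" := (imeet (fun x => .. (imeet (fun y => t)) ..))
  (at level 200, x binder, y binder, right associativity,
   format "⨅  x  ..  y ,  t") : implicative_scope.

Section Implicative.
Context {d : Order.disp_t} {A : implicativeType d}.
Implicit Types (a b c : A) (S U M : set A).

Record separator S : Prop := Separator {
  sep_up : forall a b, a <= b -> S a -> S b;
  sep_K : S (⨅ a b, a ~> b ~> a);
  sep_S : S (⨅ a b c, (a ~> b ~> c) ~> (a ~> b) ~> a ~> c);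
  sep_mp : forall a b, S a -> S (a ~> b) -> S b
}.

Definition sqmeet a b : A := ⨅ c, (a ~> b ~> c) ~> c.

Definition ex U : A := ⨅ c, bigmeet [set u ~> c | u in U] ~> c.

Definition famle S (X : Type) (u v : X -> A) : Prop := S (⨅ x, u x ~> v x).

Definition fameq S (X : Type) (u v : X -> A) : Prop :=
  famle S u v /\ famle S v u.

Definition algebraic M : Prop := forall a b, M a -> M b -> M (sqmeet a b).

(* [nonempty_subsets M], like any other set below, is used as a type through the
   coercion [set_type]. *)
Definition nonempty_subsets M : set (set A) := [set U | U `<=` M /\ U !=set0].

Definition valuation M (X : Type) : Type := X -> nonempty_subsets M.

Definition ex_val M (X : Type) (nu : valuation M X) : X -> A :=
  fun x => ex (\val (nu x)).

Definition dense M S : Prop :=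
  exists nu : valuation M S, fameq S (fun s : S => \val s) (ex_val nu).

End Implicative.

Section Separator.
Context {d : Order.disp_t} {A : implicativeType d}.

Lemma imeet_le (I : Type) (F : I -> A) i : imeet F <= F i.
Proof. by have [lb _] := bigmeetP (range F); apply: lb; exists i. Qed.

Lemma le_imeet (I : Type) (F : I -> A) a :
  (forall i, a <= F i) -> a <= imeet F.
Proof.
by move=> h; have [_ glb] := bigmeetP (range F); apply: glb => _ [i _ <-].
Qed.

Lemma imp_imeet (I : Type) (F : I -> A) a :
  a ~> imeet F = imeet (fun i => a ~> F i).
Proof. by rewrite /imeet imp_bigmeet image_comp. Qed.

Variable S : set A.
Hypothesis hS : separator S.

Definition ent (I : Type) (F : I -> A) : Prop := S (imeet F).

Lemma ent_le (I : Type) (F G : I -> A) :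
  ent F -> (forall i, F i <= G i) -> ent G.
Proof.
move=> hF FG; apply: sep_up hF => //; apply: le_imeet => i.
exact: Order.POrderTheory.le_trans (imeet_le F i) (FG i).
Qed.

Lemma ent_cst (I : Type) a : S a -> ent (fun _ : I => a).
Proof. by move=> h; apply: sep_up h => //; apply: le_imeet => i. Qed.

Lemma ent_comp (I J : Type) (h : J -> I) (F : I -> A) :
  ent F -> ent (fun j => F (h j)).
Proof.
by move=> hF; apply: sep_up hF => //; apply: le_imeet => j; apply: imeet_le.
Qed.

Lemma ent_at (I : Type) (F : I -> A) i : ent F -> S (F i).
Proof. by move=> hF; apply: sep_up hF => //; apply: imeet_le. Qed.

Lemma ent_mp (I : Type) (F G : I -> A) :
  ent (fun i => F i ~> G i) -> ent F -> ent G.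
Proof.
move=> hFG hF; apply: (sep_mp hS hF); apply: (sep_up hS _ hFG).
rewrite imp_imeet; apply: le_imeet => i.
apply: (Order.POrderTheory.le_trans (imeet_le _ i)).
by apply: imp_antil; apply: imeet_le.
Qed.

Lemma ent_K (I : Type) (F G : I -> A) : ent (fun i => F i ~> G i ~> F i).
Proof.
apply: (ent_le (ent_cst I (sep_K hS))) => i.
exact: Order.POrderTheory.le_trans (imeet_le _ (F i)) (imeet_le _ (G i)).
Qed.

Lemma ent_S (I : Type) (F G H : I -> A) :
  ent (fun i => (F i ~> G i ~> H i) ~> (F i ~> G i) ~> F i ~> H i).
Proof.
apply: (ent_le (ent_cst I (sep_S hS))) => i.
apply: (Order.POrderTheory.le_trans (imeet_le _ (F i))).
exact: Order.POrderTheory.le_trans (imeet_le _ (G i)) (imeet_le _ (H i)).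
Qed.

Lemma ent_k (I : Type) (F G : I -> A) : ent F -> ent (fun i => G i ~> F i).
Proof. exact/ent_mp/ent_K. Qed.

Lemma ent_s (I : Type) (F G H : I -> A) :
  ent (fun i => F i ~> G i ~> H i) -> ent (fun i => F i ~> G i) ->
  ent (fun i => F i ~> H i).
Proof. by move=> h; apply/ent_mp/(ent_mp (ent_S F G H)). Qed.

Lemma ent_id (I : Type) (F : I -> A) : ent (fun i => F i ~> F i).
Proof. exact: ent_s (ent_K F (fun i => F i ~> F i)) (ent_K F F). Qed.

Lemma ent_trans (I : Type) (G F H : I -> A) :
  ent (fun i => F i ~> G i) -> ent (fun i => G i ~> H i) ->
  ent (fun i => F i ~> H i).
Proof. by move=> FG GH; apply: ent_s FG; apply: ent_k. Qed.

Lemma ent_app (I : Type) (F G : I -> A) :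
  ent (fun i => F i ~> (F i ~> G i) ~> G i).
Proof.
pose P i := F i ~> G i.
have h : ent (fun i => (P i ~> F i) ~> P i ~> G i).
  exact: ent_mp (ent_S P F G) (ent_id P).
exact: ent_trans (ent_K F P) h.
Qed.

Lemma ent_imeet (I J : Type) (F : I -> A) (G : I -> J -> A) :
  ent (fun p : I * J => F p.1 ~> G p.1 p.2) ->
  ent (fun i => F i ~> ⨅ j, G i j).
Proof.
move=> h; apply: (sep_up hS _ h); apply: le_imeet => i.
rewrite imp_imeet; apply: le_imeet => j.
exact: (imeet_le (fun p : I * J => F p.1 ~> G p.1 p.2) (i, j)).
Qed.

Lemma ent_sqmeet (I : Type) (F G H : I -> A) :
  ent (fun i => H i ~> F i) -> ent (fun i => H i ~> G i) ->
  ent (fun i => H i ~> sqmeet (F i) (G i)).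
Proof.
move=> HF HG; apply: ent_imeet.
pose f (p : I * A) := F p.1; pose g (p : I * A) := G p.1.
pose h (p : I * A) := H p.1.
pose c p := f p ~> g p ~> p.2.
change (ent (fun p => h p ~> c p ~> p.2)).
have hf : ent (fun p => h p ~> c p ~> g p ~> p.2).
  exact: ent_trans (ent_comp fst HF) (ent_app f (fun p => g p ~> p.2)).
have hg : ent (fun p => h p ~> c p ~> g p).
  exact: ent_trans (ent_comp fst HG) (ent_K g c).
apply: ent_s hg.
exact: ent_trans hf (ent_S c g (fun p => p.2)).
Qed.

Lemma ent_sqmeet_l (I : Type) (F G : I -> A) :
  ent (fun i => sqmeet (F i) (G i) ~> F i).
Proof.
have h : ent (fun i => sqmeet (F i) (G i) ~> (F i ~> G i ~> F i) ~> F i).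
  apply: ent_le (ent_id (fun i => sqmeet (F i) (G i))) _ => i.
  by apply: imp_monor; apply: (imeet_le _ (F i)).
by apply: ent_s h _; apply: ent_k; apply: ent_K.
Qed.

Lemma ent_sqmeet_r (I : Type) (F G : I -> A) :
  ent (fun i => sqmeet (F i) (G i) ~> G i).
Proof.
have h : ent (fun i => sqmeet (F i) (G i) ~> (F i ~> G i ~> G i) ~> G i).
  apply: ent_le (ent_id (fun i => sqmeet (F i) (G i))) _ => i.
  by apply: imp_monor; apply: (imeet_le _ (G i)).
by apply: ent_s h _; apply: ent_k; apply: ent_k; apply: ent_id.
Qed.

Lemma ent_ex_intro (I : Type) (F : I -> A) (U : I -> set A) :
  (forall i, U i (F i)) -> ent (fun i => F i ~> ex (U i)).
Proof.
move=> FU; apply: ent_imeet => /=.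
apply: ent_le (ent_app (fun p : I * A => F p.1) (fun p => p.2)) _ => -[i c] /=.
apply: imp_monor; apply: imp_antil.
by have [lb _] := bigmeetP [set u ~> c | u in U i]; apply: lb; exists (F i).
Qed.

Lemma ent_ex_elim (I : Type) (F : I -> A) (U : I -> set A) :
  ent (fun p : {p : I * A | U p.1 p.2} => (sval p).2 ~> F (sval p).1) ->
  ent (fun i => ex (U i) ~> F i).
Proof.
move=> h.
have h1 : ent (fun i => bigmeet [set u ~> F i | u in U i]).
  apply: (sep_up hS _ h); apply: le_imeet => i.
  have [_ glb] := bigmeetP [set u ~> F i | u in U i]; apply: glb => _ [u Uu <-].
  exact: (imeet_le (fun p : {p : I * A | U p.1 p.2} =>
    (sval p).2 ~> F (sval p).1) (exist _ (i, u) Uu)).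
have h2 : ent (fun i => ex (U i) ~> bigmeet [set u ~> F i | u in U i] ~> F i).
  apply: ent_le (ent_id (fun i => ex (U i))) _ => i.
  by apply: imp_monor; apply: (imeet_le _ (F i)).
by apply: ent_s h2 _; apply: ent_k.
Qed.

Lemma sep_ex (U : set A) : U !=set0 -> U `<=` S -> S (ex U).
Proof.
move=> [u Uu] US; have h : ent (fun _ : unit => u ~> ex U) by apply: ent_ex_intro.
exact: sep_mp (US _ Uu) (ent_at tt h).
Qed.

Lemma sep_sqmeet a b : S a -> S b -> S (sqmeet a b).
Proof.
move=> Sa Sb.
have e := ent_sqmeet (ent_id (fun _ : unit => a)) (ent_k (fun=> a) (ent_cst unit Sb)).
exact: sep_mp Sa (ent_at tt e).
Qed.

End Separator.

Record category := Category {
  obj :> Type;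
  hom : obj -> obj -> Type;
  idm : forall X, hom X X;
  comp : forall X Y Z, hom Y Z -> hom X Y -> hom X Z;
  compA : forall X Y Z W (h : hom Z W) (g : hom Y Z) (f : hom X Y),
    comp h (comp g f) = comp (comp h g) f;
  comp1m : forall X Y (f : hom X Y), comp (idm Y) f = f;
  compm1 : forall X Y (f : hom X Y), comp f (idm X) = f
}.
Arguments hom {c} X Y.
Arguments idm {c} X.
Arguments comp {c X Y Z} g f.
Arguments compA {c X Y Z W} h g f.

Notation "g ∘ f" := (comp g f) (at level 40, left associativity).

Record functor (C D : category) := Functor {
  fobj :> C -> D;
  fmap : forall X Y, hom X Y -> hom (fobj X) (fobj Y);
  fmap_id : forall X, fmap (idm X) = idm (fobj X);
  fmap_comp : forall X Y Z (g : hom Y Z) (f : hom X Y),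
    fmap (g ∘ f) = fmap g ∘ fmap f
}.

Definition isomorphic (C : category) (X Y : C) : Prop :=
  exists (f : hom X Y) (g : hom Y X), g ∘ f = idm X /\ f ∘ g = idm Y.

Definition essentially_surjective (C D : category) (F : functor C D) : Prop :=
  forall Y : D, exists X : C, isomorphic (F X) Y.

Definition full_subcategory (C : category) (P : C -> Prop) : category :=
  @Category {X : C | P X} (fun X Y => @hom C (sval X) (sval Y))
    (fun X => idm (sval X)) (fun X Y Z g f => g ∘ f)
    (fun X Y Z W h g f => compA h g f)
    (fun X Y f => comp1m f) (fun X Y f => compm1 f).

Section Limits.
Variable C : category.

Definition is_terminal (T : C) : Prop := forall X : C, exists! f : hom X T, True.

Definition is_pullback (X Y Z P : C) (f : hom X Z) (g : hom Y Z)
    (p : hom P X) (q : hom P Y) : Prop :=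
  f ∘ p = g ∘ q /\
  forall (Q : C) (a : hom Q X) (b : hom Q Y), f ∘ a = g ∘ b ->
    exists! m : hom Q P, p ∘ m = a /\ q ∘ m = b.

Definition is_kernel_pair (X Y K : C) (f : hom X Y) (p q : hom K X) : Prop :=
  is_pullback f f p q.

Definition has_finite_limits : Prop :=
  (exists T : C, is_terminal T) /\
  (forall (X Y Z : C) (f : hom X Z) (g : hom Y Z),
     exists (P : C) (p : hom P X) (q : hom P Y), is_pullback f g p q).

End Limits.

Section RegLex.
Variable C : category.
Hypothesis lexC : has_finite_limits C.

Record reglex_obj := RegLexObj {
  rl_src : C;
  rl_tgt : C;
  rl_arr : hom rl_src rl_tgt
}.

Implicit Types F G H : reglex_obj.

(* Kernel pairs are unique up to isomorphism, and exist by [lexC]: asking the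
   equation for all of them is asking it for any chosen one. *)
Definition rl_compat F G : set (hom (rl_src F) (rl_src G)) :=
  [set l | forall (K : C) (p q : hom K (rl_src F)),
     is_kernel_pair (rl_arr F) p q ->
     (rl_arr G ∘ l) ∘ p = (rl_arr G ∘ l) ∘ q].
Arguments rl_compat F G _ : clear implicits.

Definition rl_class F G (l : hom (rl_src F) (rl_src G)) :
    set (hom (rl_src F) (rl_src G)) :=
  [set l' | rl_compat F G l' /\ rl_arr G ∘ l' = rl_arr G ∘ l].

Definition rl_classes F G : set (set (hom (rl_src F) (rl_src G))) :=
  [set rl_class l | l in rl_compat F G].
Arguments rl_classes F G _ : clear implicits.

(* The set of equivalence classes, coerced to a type. *)
Definition rl_hom F G : Type := rl_classes F G.

Definition rl_mk F G (l : hom (rl_src F) (rl_src G)) (hl : rl_compat F G l) :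
    rl_hom F G :=
  exist _ (rl_class l) (mem_set (ex_intro2 _ _ l hl erefl)).

Lemma rl_homP F G (c : rl_hom F G) :
  exists l (hl : rl_compat F G l), c = rl_mk hl.
Proof.
case: c => c hc; have [l hl lc] := set_mem hc; exists l, hl.
exact: val_inj.
Qed.

Definition rl_rep F G (c : rl_hom F G) : hom (rl_src F) (rl_src G) :=
  projT1 (cid (rl_homP c)).

Lemma rl_rep_compat F G (c : rl_hom F G) : rl_compat F G (rl_rep c).
Proof. by rewrite /rl_rep; case: cid => l /= [hl _]. Qed.

Lemma rl_mk_eq F G (l l' : hom (rl_src F) (rl_src G))
    (hl : rl_compat F G l) (hl' : rl_compat F G l') :
  rl_mk hl = rl_mk hl' <-> rl_arr G ∘ l = rl_arr G ∘ l'.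
Proof.
split=> [/(congr1 val)/= e|e].
  have : rl_class l l by split.
  by rewrite e => -[].
by apply: val_inj; rewrite /= /rl_class e.
Qed.

Lemma rl_repK F G (c : rl_hom F G) (h : rl_compat F G (rl_rep c)) :
  rl_mk h = c.
Proof.
move: h; rewrite /rl_rep; case: cid => l /= [hl ->] h.
exact/rl_mk_eq.
Qed.

Lemma rl_rep_mk F G (l : hom (rl_src F) (rl_src G)) (hl : rl_compat F G l) :
  rl_arr G ∘ rl_rep (rl_mk hl) = rl_arr G ∘ l.
Proof.
by apply/(rl_mk_eq (rl_rep_compat _)); rewrite rl_repK.
Qed.

Lemma rl_id_compat F : rl_compat F F (idm (rl_src F)).
Proof. by move=> K p q [+ _]; rewrite !compm1. Qed.

Lemma rl_comp_compat F G H (l' : hom (rl_src G) (rl_src H))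
    (l : hom (rl_src F) (rl_src G)) :
  rl_compat G H l' -> rl_compat F G l -> rl_compat F H (l' ∘ l).
Proof.
move=> hl' hl K p q /hl; rewrite -!compA => e.
have [_ /(_ _ _ _ (rl_arr G) (rl_arr G))[K' [p' [q' kp]]]] := lexC.
have [_ /(_ _ _ _ e)[m [[<- <-] _]]] := kp.
have := hl' _ _ _ kp.
by rewrite !compA => ->.
Qed.

Lemma rl_comp_congr F G H (l' m' : hom (rl_src G) (rl_src H))
    (l m : hom (rl_src F) (rl_src G)) :
  rl_compat G H l' ->
  rl_arr H ∘ l' = rl_arr H ∘ m' -> rl_arr G ∘ l = rl_arr G ∘ m ->
  rl_arr H ∘ (l' ∘ l) = rl_arr H ∘ (m' ∘ m).
Proof.
move=> hl' e' e.
have [_ /(_ _ _ _ (rl_arr G) (rl_arr G))[K' [p' [q' kp]]]] := lexC.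
have -> : rl_arr H ∘ (l' ∘ l) = rl_arr H ∘ (l' ∘ m).
  have [_ /(_ _ _ _ e)[k [[<- <-] _]]] := kp.
  have := hl' _ _ _ kp.
  by rewrite !compA => ->.
by rewrite !compA e'.
Qed.

Definition rl_idm F : rl_hom F F := rl_mk (@rl_id_compat F).

Definition rl_comp F G H (c' : rl_hom G H) (c : rl_hom F G) : rl_hom F H :=
  rl_mk (rl_comp_compat (rl_rep_compat c') (rl_rep_compat c)).

Lemma rl_comp_mk F G H (l' : hom (rl_src G) (rl_src H))
    (l : hom (rl_src F) (rl_src G))
    (hl' : rl_compat G H l') (hl : rl_compat F G l) :
  rl_comp (rl_mk hl') (rl_mk hl) = rl_mk (rl_comp_compat hl' hl).
Proof.
apply/rl_mk_eq; apply: rl_comp_congr; first exact: rl_rep_compat.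
- exact: rl_rep_mk.
- exact: rl_rep_mk.
Qed.

Lemma rl_compA F G H L (z : rl_hom H L) (y : rl_hom G H) (x : rl_hom F G) :
  rl_comp z (rl_comp y x) = rl_comp (rl_comp z y) x.
Proof.
have [? [? ->]] := rl_homP x; have [? [? ->]] := rl_homP y.
have [? [? ->]] := rl_homP z.
by rewrite !rl_comp_mk; apply/rl_mk_eq; rewrite !compA.
Qed.

Lemma rl_comp1m F G (x : rl_hom F G) : rl_comp (rl_idm G) x = x.
Proof.
by have [? [? ->]] := rl_homP x; rewrite rl_comp_mk; apply/rl_mk_eq; rewrite comp1m.
Qed.

Lemma rl_compm1 F G (x : rl_hom F G) : rl_comp x (rl_idm F) = x.
Proof.
by have [? [? ->]] := rl_homP x; rewrite rl_comp_mk; apply/rl_mk_eq; rewrite compm1.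
Qed.

Definition reglex : category :=
  Category rl_compA rl_comp1m rl_compm1.

End RegLex.
Arguments rl_compat {C} F G _.

Section Assemblies.
Context {d : Order.disp_t} {A : implicativeType d}.
Variable S : set A.
Hypothesis hS : separator S.

Record assembly := Assembly {
  acarrier :> Type;
  aE : acarrier -> A;
  aE_sep : forall x, S (aE x)
}.
Arguments aE {a} x.

Definition tracked (X Y : assembly) (f : X -> Y) : Prop :=
  S (⨅ x, aE x ~> aE (f x)).

Record asm_hom (X Y : assembly) := AsmHom {
  afun :> X -> Y;
  afun_tracked : tracked afun
}.

Lemma asm_hom_eq (X Y : assembly) (f g : asm_hom X Y) :
  (forall x, f x = g x) -> f = g.
Proof.
case: f g => [f hf] [g hg] /= /funext e; move: hf; rewrite e => hf.
by congr AsmHom; apply: Prop_irrelevance.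
Qed.

Lemma tracked_id (X : assembly) : tracked (fun x : X => x).
Proof. exact: (ent_id hS (@aE X)). Qed.

Lemma tracked_comp (X Y Z : assembly) (g : asm_hom Y Z) (f : asm_hom X Y) :
  tracked (fun x => g (f x)).
Proof.
exact: (ent_trans hS (afun_tracked f) (ent_comp hS f (afun_tracked g))).
Qed.

Definition Asm : category.
Proof.
apply: (@Category assembly asm_hom (fun X => AsmHom (@tracked_id X))
  (fun X Y Z g f => AsmHom (tracked_comp g f))).
- by move=> *; apply: asm_hom_eq.
- by move=> *; apply: asm_hom_eq.
- by move=> *; apply: asm_hom_eq.
Defined.

Definition valued_in (M : set A) (X : Asm) : Prop := forall x : X, M (aE x).

Definition AsmSub (M : set A) : category := full_subcategory (valued_in M).

Section Image.
Variables (X Y : assembly) (f : asm_hom X Y).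

Definition fiber (x : X) : set X := f @^-1` [set f x].

Definition fibers : set (set X) := range fiber.

Lemma fiberP (c : fibers) : exists x, \val c = fiber x.
Proof. by have [x _ e] := set_mem (valP c); exists x. Qed.

Lemma im_E_sep (c : fibers) : S (ex [set aE x | x in \val c]).
Proof.
apply: sep_ex => //; last by move=> _ [x _ <-]; apply: aE_sep.
by have [x ->] := fiberP c; exists (aE x), x.
Qed.

Definition Im : assembly := Assembly im_E_sep.

Definition im_class (x : X) : Im := exist _ (fiber x) (mem_set (imageT fiber x)).

Lemma im_class_eq (x x' : X) : im_class x = im_class x' <-> f x = f x'.
Proof.
split=> [/(congr1 val)/= e|e].
  by have : fiber x x by []; rewrite e.
by apply: val_inj; rewrite /= /fiber e.
Qed.

Definition im_rep (c : Im) : X := projT1 (cid (fiberP c)).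

Lemma im_repK (c : Im) : im_class (im_rep c) = c.
Proof. by rewrite /im_rep; case: cid => x /= e; apply: val_inj. Qed.

Lemma im_rep_class (x : X) : f (im_rep (im_class x)) = f x.
Proof. exact/im_class_eq/im_repK. Qed.

Lemma im_mem (c : Im) (x : X) : \val c x <-> im_class x = c.
Proof.
rewrite -[c]im_repK im_class_eq; split=> //.
Qed.

Lemma im_class_tracked : @tracked X Im im_class.
Proof.
apply: (ent_ex_intro hS (U := fun x => [set aE x' | x' in \val (im_class x)])).
by move=> x; exists x.
Qed.

Lemma im_incl_tracked : @tracked Im Y (fun c => f (im_rep c)).
Proof.
apply: (ent_ex_elim hS (U := fun c : Im => [set aE x | x in \val c])).
have P (p : {p : Im * A | [set aE x | x in \val p.1] p.2}) :
    {x : X | im_class x = (sval p).1 /\ aE x = (sval p).2}.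
  by apply: cid; case: p => -[c a] /= [x /im_mem cx <-]; exists x.
apply: (ent_le hS (ent_comp hS (fun p => sval (P p)) (afun_tracked f))) => p.
by case: (P p) => x /= [<- <-]; rewrite im_rep_class.
Qed.

Definition im_cover : @hom Asm X Im := AsmHom im_class_tracked.
Definition im_incl : @hom Asm Im Y := AsmHom im_incl_tracked.

Lemma im_factor : im_incl ∘ im_cover = f :> @hom Asm X Y.
Proof. by apply: asm_hom_eq => x /=; apply: im_rep_class. Qed.

End Image.

Section Sub.
Variable M : set A.
Hypothesis MS : M `<=` S.
Hypothesis M0 : M !=set0.
Hypothesis algM : algebraic M.

Section Pullback.
Variables (X Y Z : AsmSub M) (f : hom X Z) (g : hom Y Z).

Definition pb_carrier : Type :=
  {p : (sval X : assembly) * (sval Y : assembly) |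
     afun f p.1 = afun g p.2}.

Lemma pb_eq (p q : pb_carrier) :
  (sval p).1 = (sval q).1 -> (sval p).2 = (sval q).2 -> p = q.
Proof.
case: p q => [[x y] e] [[x' y'] e'] /= ex ey; subst x' y'.
by congr exist; apply: Prop_irrelevance.
Qed.

Definition pb_E (p : pb_carrier) : A := sqmeet (aE (sval p).1) (aE (sval p).2).

Lemma pb_E_M p : M (pb_E p).
Proof. by apply: algM; [apply: (svalP X)|apply: (svalP Y)]. Qed.

Definition pb_assembly : assembly := Assembly (fun p => MS (pb_E_M p)).

Definition pb : AsmSub M := exist _ pb_assembly pb_E_M.

Definition pb_fst : hom pb X :=
  @AsmHom pb_assembly (sval X) (fun p : pb_carrier => (sval p).1)
    (ent_sqmeet_l hS _ _).

Definition pb_snd : hom pb Y :=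
  @AsmHom pb_assembly (sval Y) (fun p : pb_carrier => (sval p).2)
    (ent_sqmeet_r hS _ _).

Lemma pbP : is_pullback f g pb_fst pb_snd.
Proof.
split=> [|Q a b e]; first by apply: asm_hom_eq => -[].
have ab x : afun f (afun a x) = afun g (afun b x).
  by move/(congr1 (fun h : asm_hom _ _ => afun h x)): e.
pose m x : pb_assembly := exist _ (afun a x, afun b x) (ab x).
have hm : tracked m.
  exact: (ent_sqmeet hS (afun_tracked a) (afun_tracked b)).
exists (AsmHom hm); split=> [|m' [ea eb]].
  by split; apply: asm_hom_eq.
subst a b.
by apply: asm_hom_eq => x; apply: pb_eq.
Qed.

End Pullback.

Lemma AsmSub_terminal : exists T : AsmSub M, is_terminal T.
Proof.
have [m Mm] := M0.
pose T : assembly := @Assembly unit (fun=> m) (fun=> MS Mm).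
exists (exist (valued_in M) T (fun=> Mm)) => X.
have h : @tracked (sval X) T (fun=> tt).
  exact: (ent_k hS _ (ent_cst hS _ (MS Mm))).
exists (AsmHom h); split=> // g _.
by apply: asm_hom_eq => x; case: (afun g x).
Qed.

Lemma AsmSub_lex : has_finite_limits (AsmSub M).
Proof.
split=> [|X Y Z f g]; first exact: AsmSub_terminal.
by exists (pb f g), (pb_fst f g), (pb_snd f g); apply: pbP.
Qed.

Definition AsmSub_reglex : category := reglex AsmSub_lex.

Section Tilde.
Variables (F G : reglex_obj (AsmSub M)).
Let f : asm_hom (sval (rl_src F)) (sval (rl_tgt F)) := rl_arr F.
Let g : asm_hom (sval (rl_src G)) (sval (rl_tgt G)) := rl_arr G.
Variable l : hom (rl_src F) (rl_src G).
Hypothesis hl : rl_compat F G l.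

Lemma compat_fun x x' : f x = f x' -> g (afun l x) = g (afun l x').
Proof.
move=> e; have := hl (pbP (rl_arr F) (rl_arr F)).
pose z : pb_assembly (rl_arr F) (rl_arr F) := exist _ (x, x') e.
by move/(congr1 (fun h : asm_hom _ _ => afun h z)).
Qed.

(* The choice of a representative is immaterial: see [tilde_class],
   [tilde_spec] and [tilde_unique]. *)
Definition tilde_fun (c : Im f) : Im g := im_class g (afun l (im_rep c)).

Lemma tilde_class x : tilde_fun (im_class f x) = im_class g (afun l x).
Proof. by apply/im_class_eq/compat_fun/im_rep_class. Qed.

Lemma tilde_tracked : tracked tilde_fun.
Proof.
apply: (ent_ex_elim hS (U := fun c : Im f => [set aE x | x in \val c])).
have P (p : {p : Im f * A | [set aE x | x in \val p.1] p.2}) :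
    {x | im_class f x = (sval p).1 /\ aE x = (sval p).2}.
  by apply: cid; case: p => -[c a] /= [x /im_mem cx <-]; exists x.
have h : tracked (fun x => im_class g (afun l x)).
  exact: (ent_trans hS (afun_tracked l)
           (ent_comp hS (afun l) (im_class_tracked g))).
apply: (ent_le hS (ent_comp hS (fun p => sval (P p)) h)) => p.
case: (P p) => x /= [<- <-].
change (aE x ~> aE (im_class g (afun l x)) <=
        aE x ~> aE (tilde_fun (im_class f x))).
by rewrite tilde_class.
Qed.

Definition tilde : @hom Asm (Im f) (Im g) := AsmHom tilde_tracked.

Lemma tilde_spec : tilde ∘ im_cover f = im_cover g ∘ (l : @hom Asm _ _).
Proof. by apply: asm_hom_eq => x; apply: tilde_class. Qed.

Lemma tilde_unique (t : @hom Asm (Im f) (Im g)) :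
  t ∘ im_cover f = im_cover g ∘ (l : @hom Asm _ _) -> t = tilde.
Proof.
move=> e; apply: asm_hom_eq => c; rewrite -(im_repK c).
apply: etrans (esym (tilde_class _)).
by move/(congr1 (fun h : asm_hom _ _ => h (im_rep c))): e.
Qed.

End Tilde.

Definition U_obj (F : AsmSub_reglex) : Asm :=
  Im (rl_arr F : asm_hom (sval (rl_src F)) (sval (rl_tgt F))).

Definition U_map (F G : AsmSub_reglex) (c : hom F G) :
    hom (U_obj F) (U_obj G) :=
  tilde (rl_rep_compat c).

Lemma U_map_mk (F G : AsmSub_reglex) (l : hom (rl_src F) (rl_src G))
    (hl : rl_compat F G l) : U_map (rl_mk hl) = tilde hl.
Proof.
apply: asm_hom_eq => c /=; apply/im_class_eq.
have := rl_rep_mk hl.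
by move/(congr1 (fun h : asm_hom _ _ => afun h (im_rep c))).
Qed.

Lemma U_map_id (F : AsmSub_reglex) : U_map (idm F) = idm (U_obj F).
Proof. by rewrite U_map_mk; apply: asm_hom_eq => c /=; apply: im_repK. Qed.

Lemma U_map_comp (F G H : AsmSub_reglex) (y : hom G H) (x : hom F G) :
  U_map (y ∘ x) = U_map y ∘ U_map x.
Proof.
have [l [hl ->]] := rl_homP x; have [l' [hl' ->]] := rl_homP y.
rewrite [_ ∘ _](rl_comp_mk AsmSub_lex hl' hl) !U_map_mk.
apply: asm_hom_eq => c.
change (tilde_fun (l' ∘ l) c = tilde_fun l' (tilde_fun l c)).
exact: (esym (tilde_class hl' _)).
Qed.

Definition U : functor AsmSub_reglex Asm := Functor U_map_id U_map_comp.

End Sub.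
End Assemblies.

(* Main.v *)
(** An assembly is a family of elements of the separator indexed by its carrier.
    The family [E_Y] is equivalent to [ex nu] for a valuation [nu] in [M]
    exactly when [Y] is the image of an arrow of [Asm_M]: from [nu] one takes
    the total space [{(y, m) | m \in nu y}], with realizer [m], projected to the
    carrier of [Y]; conversely, each fibre of an arrow of [Asm_M] has a
    nonempty set of realizers in [M].  Density is the case of the generic family
    [id_S], from which every other family is obtained by reindexing. *)
Require Import Defs.
From mathcomp Require Import all_boot all_order.
From mathcomp Require Import boolp classical_sets.

Set Implicit Arguments.
Unset Strict Implicit.
Unset Printing Implicit Defensive.

Local Open Scope classical_set_scope.

Section ImagePresentation.
Context {d : Order.disp_t} {A : implicativeType d}.
Variables (S : set A) (hS : separator S).
Variables (M : set A) (hMS : M `<=` S).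

Section Valuation.
Variables (Y : assembly S) (nu : valuation M Y).

Definition total_carrier : Type :=
  {p : Y * A | (\val (nu p.1) : set A) p.2}.

Definition total_E (p : total_carrier) : A := (sval p).2.

Lemma total_E_M p : M (total_E p).
Proof. by have [h _] := set_mem (valP (nu (sval p).1)); apply/h/(svalP p). Qed.

Definition total_assembly : assembly S :=
  Assembly (fun p : total_carrier => hMS (total_E_M p)).

Definition total : AsmSub hS M :=
  exist (valued_in (hS := hS) M) total_assembly total_E_M.

Variables (m : A) (Mm : M m).

(** The constant realizer [m] makes every map into this assembly tracked, so [total_proj] is an
    arrow between [M]-valued assemblies even when [Y] is not [M]-valued. *)
Definition codiscrete_assembly : assembly S :=
  @Assembly d A S Y (fun=> m) (fun=> hMS Mm).

Definition codiscrete : AsmSub hS M :=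
  exist (valued_in (hS := hS) M) codiscrete_assembly (fun=> Mm).

Definition total_proj_fun (p : total_assembly) : codiscrete_assembly :=
  (sval p).1.

Lemma total_proj_tracked : tracked total_proj_fun.
Proof. exact: (ent_k hS _ (ent_cst hS _ (hMS Mm))). Qed.

Definition total_proj : asm_hom total_assembly codiscrete_assembly :=
  AsmHom total_proj_tracked.

Definition im_total_point (c : Im hS total_proj) : Y :=
  total_proj_fun (im_rep c).

Definition total_point (y : Y) : total_assembly :=
  let h := cid (proj2 (set_mem (valP (nu y)))) in
  exist (fun p : Y * A => (\val (nu p.1) : set A) p.2) (y, sval h) (svalP h).

Definition im_total_class (y : Y) : Im hS total_proj :=
  im_class hS total_proj (total_point y).

Lemma im_total_classK : cancel im_total_class im_total_point.
Proof. by move=> y; apply: (@im_rep_class _ _ _ hS _ _ total_proj). Qed.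

Lemma im_total_pointK : cancel im_total_point im_total_class.
Proof. by move=> c; rewrite -[RHS]im_repK; apply/im_class_eq. Qed.

(** The fibre over [y] is [{y}] times [nu y], whichever element [total_point] chose, so its set of
    realizers is [nu y] itself. *)
Lemma im_total_E (y : Y) : aE (im_total_class y) = ex_val nu y.
Proof.
rewrite /= /ex_val; congr ex; apply/seteqP; split=> [_ [[[z a] /= h] e <-]|a h].
  by move: e => /= e; rewrite -[y]e.
by exists (exist (fun p : Y * A => (\val (nu p.1) : set A) p.2) (y, a) h).
Qed.

(** By [im_total_E], each half of the equivalence tracks one direction of the bijection between the
    image and [Y]. *)
Lemma im_total_iso :
  fameq S (@aE _ _ _ Y) (ex_val nu) ->
  isomorphic (C := Asm hS) (Im hS total_proj) Y.
Proof.
move=> [Ynu nuY].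
have tpoint : tracked im_total_point.
  apply: ent_le (ent_comp hS im_total_point nuY) _ => // c.
  by rewrite -im_total_E im_total_pointK.
have tclass : tracked im_total_class.
  by apply: ent_le Ynu _ => // y; rewrite -im_total_E.
exists (AsmHom tpoint : @hom (Asm hS) _ _).
exists (AsmHom tclass : @hom (Asm hS) _ _).
by split; apply: asm_hom_eq => ?; [apply: im_total_pointK|apply: im_total_classK].
Qed.

End Valuation.

(** Take for [nu y] the realizers of the points in the fibre [psi y]; then [ex (nu y)] is by
    definition the realizer of [psi y] in the image. *)
Lemma valuation_of_im (X Z Y : assembly S) (f : asm_hom X Z) :
  (forall x : X, M (aE x)) -> isomorphic (C := Asm hS) (Im hS f) Y ->
  exists nu : valuation M Y, fameq S (@aE _ _ _ Y) (ex_val nu).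
Proof.
move=> XM [phi [psi [_ /(congr1 (fun h : asm_hom _ _ => afun h)) phipsi]]].
pose U y : set A := [set aE x | x in \val (afun psi y)].
have hU y : nonempty_subsets M (U y).
  split=> [_ [x _ <-]//|].
  by have [x e] := fiberP (afun psi y); exists (aE x), x => //; rewrite e.
exists (fun y => exist _ (U y) (mem_set (hU y))); split.
  exact: (afun_tracked psi).
(* Tracking of [phi], reindexed along [psi], ends in the realizer of [phi (psi y)], which is [y]. *)
apply: (ent_le hS (ent_comp hS (afun psi) (afun_tracked phi))) => y.
by move/(congr1 (fun h => h y)): phipsi => /= ->.
Qed.

End ImagePresentation.

Theorem theorem4p1 (d : Order.disp_t) (A : implicativeType d)
    (S : set A) (hS : separator S)
    (M : set A) (hMS : M `<=` S) (hM0 : M !=set0) (hM : algebraic M) :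
  [<-> dense M S;
       forall (X : Type) (u : X -> S),
         exists nu : valuation M X,
           fameq S (fun x => \val (u x)) (ex_val nu);
       essentially_surjective (U hS hMS hM0 hM)].
Proof.
tfae.
- move=> [nu [Snu nuS]] X u; exists (nu \o u).
  by split; [apply: (ent_comp hS u Snu)|apply: (ent_comp hS u nuS)].
- move=> hval Y; have [m Mm] := hM0.
  have [nu e] := hval Y (fun y => exist _ (aE y) (mem_set (aE_sep y))).
  exists (@RegLexObj (AsmSub hS M) (total hS hMS nu) (codiscrete hS hMS Y Mm)
            (total_proj hS hMS nu Mm)).
  exact: im_total_iso.
- move=> hess.
  (* The generic assembly: each element of [S] is its own realizer. *)
  pose Y : assembly S := @Assembly _ _ _ S \val (fun s => set_mem (valP s)).
  have [F iso] := hess Y.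
  exact: (valuation_of_im (svalP (rl_src F)) iso).
Qed.
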